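(* Let $G$ be a finite abelian group and let $(\mathcal X,\mathcal K)$ be a supercharacter theory of $G$. Then $(\widetilde{\mathcal K},\mathcal X)$ is a supercharacter theory of the group $\mathrm{Irr}(G)$.
   Context: $\mathrm{Irr}(G)$ is the set of complex irreducible characters of $G$; for abelian $G$ it is an abelian group under pointwise multiplication. A supercharacter theory of a finite group $G$ is a pair $(\mathcal X,\mathcal K)$, with $\mathcal X$ a partition of $\mathrm{Irr}(G)$ and $\mathcal K$ a partition of $G$, such that $|\mathcal X|=|\mathcal K|$ and for every $X\in\mathcal X$ there is a character $\chi_X$ of $G$ whose irreducible constituents lie in $X$, with each $\chi_X$ constant on every part $K\in\mathcal K$, and every irreducible character of $G$ a constituent of some $\chi_X$. (It is known, by Diaconis and Isaacs, that $\chi_X$ is then a constant multiple of $\sigma_X=\sum_{\psi\in X}\psi(1)\psi$, and one always takes $\chi_X=\sigma_X$.) For abelian $G$, the natural isomorphism $G\to\mathrm{Irr}(\mathrm{Irr}(G))$, $g\mapsto\widetilde g$, is given by $\widetilde g(\chi)=\chi(g)$. For $K\subseteq G$, $\widetilde K=\{\widetilde g: g\in K\}$, and for a partition $\mathcal K$ of $G$, $\widetilde{\mathcal K}=\{\widetilde K: K\in\mathcal K\}$, a partition of $\mathrm{Irr}(\mathrm{Irr}(G))$. *)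

(* Defs.v *)
From HB Require Import structures.
From mathcomp Require Import all_boot all_order all_algebra all_fingroup.
From mathcomp Require Import all_solvable all_field all_character.

Set Implicit Arguments.
Unset Strict Implicit.
Unset Printing Implicit Defensive.

Import GroupScope GRing.Theory.
Local Open Scope ring_scope.

(* Irr(G) is represented by its index type Iirr G, with 'chi_i the character
   of index i.  The zero class function satisfies "\is a character", but it
   cannot occur as some chi A below: the parts of XX are nonempty, and the last
   clause forces each i in A to be a constituent of chi A. *)
Definition supercharacter_theory (gT : finGroupType) (G : {group gT})
    (XX : {set {set Iirr G}}) (KK : {set {set gT}}) : Prop :=
  [/\ partition XX [set: Iirr G],
      partition KK G,
      #|XX| = #|KK|
    & exists chi : {set Iirr G} -> 'CF(G),
        [/\ forall A, A \in XX -> chi A \is a character,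
            forall A, A \in XX -> {subset irr_constt (chi A) <= A},
            forall A K, A \in XX -> K \in KK ->
              {in K &, forall x y, chi A x = chi A y}
          & forall i : Iirr G, exists2 A, A \in XX & i \in irr_constt (chi A)]].

Arguments supercharacter_theory {gT} G XX KK.

(* The carrier is an alias of Iirr G, an ordinal type 'I_n.+1; the alias keeps
   pointwise multiplication apart from addition mod n.+1, which is the default
   group structure on ordinals. *)
Definition dual_group (gT : finGroupType) (G : {group gT}) (cGG : abelian G) :
  Type := Iirr G.

Section DualGroup.

Variables (gT : finGroupType) (G : {group gT}) (cGG : abelian G).
Local Notation dG := (dual_group cGG).

HB.instance Definition _ := Finite.copy dG (Iirr G).

Definition dual_one : dG := cfIirr (1 : 'CF(G)).
Definition dual_mul (i j : dG) : dG := cfIirr ('chi[G]_i * 'chi[G]_j).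
Definition dual_inv (i : dG) : dG := cfIirr ('chi[G]_i)^-1.

Lemma dual_lin (i : Iirr G) : 'chi_i \is a linear_char.
Proof. exact/char_abelianP. Qed.

Lemma dual_oneE : 'chi[G]_dual_one = 1.
Proof. by rewrite cfIirrE // lin_char_irr ?rpred1. Qed.

Lemma dual_mulE i j : 'chi[G]_(dual_mul i j) = 'chi[G]_i * 'chi[G]_j.
Proof. by rewrite cfIirrE // lin_char_irr ?rpredM ?dual_lin. Qed.

Lemma dual_invE i : 'chi[G]_(dual_inv i) = ('chi[G]_i)^-1.
Proof. by rewrite cfIirrE // lin_char_irr ?rpredV ?dual_lin. Qed.

Fact dual_mulA : associative dual_mul.
Proof. by move=> i j k; apply: irr_inj; rewrite !dual_mulE mulrA. Qed.

Fact dual_mul1 : left_id dual_one dual_mul.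
Proof. by move=> i; apply: irr_inj; rewrite dual_mulE dual_oneE mul1r. Qed.

Fact dual_mulV : left_inverse dual_one dual_inv dual_mul.
Proof.
move=> i; apply: irr_inj.
by rewrite dual_mulE dual_invE dual_oneE mulVr ?lin_char_unitr ?dual_lin.
Qed.

HB.instance Definition _ :=
  Finite_isGroup.Build dG dual_mulA dual_mul1 dual_mulV.

Lemma dual_mulgE (i j : dG) : 'chi[G]_(i * j)%g = 'chi[G]_i * 'chi[G]_j.
Proof. exact: dual_mulE. Qed.

Lemma dual_abelian : abelian [set: dG].
Proof.
apply/centsP=> i _ j _; apply: irr_inj.
by rewrite !dual_mulgE mulrC.
Qed.

Fact dual_eval_subproof (g : gT) :
  is_class_fun <<[set: dG]>> [ffun i : dG => 'chi[G]_i g].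
Proof.
rewrite genGid; apply: intro_class_fun => [i j _ _|i]; last by rewrite inE.
by rewrite conjgE (centsP dual_abelian i _ j) ?inE // mulKg.
Qed.
Definition dual_eval (g : gT) : 'CF([set: dG]) := Cfun 0 (dual_eval_subproof g).

Lemma dual_evalE g (i : dG) : dual_eval g i = 'chi[G]_i g.
Proof. exact: cfunE. Qed.

Lemma dual_eval_lin g : g \in G -> dual_eval g \is a linear_char.
Proof.
move=> Gg; have chi1 : dual_eval g 1%g = 1.
  by rewrite dual_evalE [X in 'chi_X]/(1%g : dG) dual_oneE cfun1E Gg.
have rgP : mx_repr [set: dG] (fun i : dG => ('chi[G]_i g)%:M : 'M[algC]_1).
  split=> [|i j _ _]; first by rewrite -dual_evalE chi1.
  by rewrite dual_mulgE cfunE scalar_mxM.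
rewrite qualifE /= chi1 eqxx andbT.
suff ->: dual_eval g = cfRepr (MxRepresentation rgP) by apply: cfRepr_char.
by apply/cfunP=> i; rewrite dual_evalE cfunE inE mxtrace_scalar.
Qed.

(* Only meaningful for g \in G, see tildeE; for g outside G, dual_eval g is
   zero and cfIirr returns a junk value. *)
Definition tilde (g : gT) : Iirr [set: dG] := cfIirr (dual_eval g).

Lemma tildeE g (i : dG) :
  g \in G -> 'chi[[set: dG]]_(tilde g) i = 'chi[G]_i g.
Proof.
by move=> Gg; rewrite cfIirrE ?dual_evalE // lin_char_irr ?dual_eval_lin.
Qed.

Definition tilde_part (KK : {set {set gT}}) : {set {set Iirr [set: dG]}} :=
  [set tilde @: K | K : {set gT} in KK].

End DualGroup.

(* Main.v *)
(** Since the characters chi_X have disjoint constituents and there are as many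
    of them as parts of K, they form a basis of the functions constant on the
    parts of K.  The part of 1 lies in the kernel of every chi_X, hence is {1},
    so the regular character is one of these functions; projecting it onto the
    span of X shows that chi_X is a multiple of the sum of X.  Therefore
    psi |-> <f, psi> is constant on every X as soon as f is constant on the
    parts of K.  With f the indicator function of K in K, this says that the
    sum of the characters in K~ is constant on every X. *)
Require Import Defs.
From mathcomp Require Import all_boot all_order all_algebra all_fingroup.
From mathcomp Require Import all_solvable all_field all_character.

Set Implicit Arguments.
Unset Strict Implicit.
Unset Printing Implicit Defensive.

Import GroupScope GRing.Theory Num.Theory.
Local Open Scope ring_scope.

Definition superclass_fun (gT : finGroupType) (G : {group gT})
    (KK : {set {set gT}}) (f : 'CF(G)) : Prop :=
  forall K, K \in KK -> {in K &, forall x y, f x = f y}.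

(** A class function indicator is faithful on normal subsets; every subset of an abelian group is
    normal in it. *)
Lemma cfuni_abelianE (gT : finGroupType) (G : {group gT}) (K : {set gT}) x :
  abelian G -> K \subset G -> ('1_K : 'CF(G)) x = (x \in K)%:R.
Proof.
move=> cGG sKG; apply: cfuniE; apply/andP; split=> //.
exact: sub_abelian_norm.
Qed.

Lemma superclass_fun_span (gT : finGroupType) (G : {group gT})
    (KK : {set {set gT}}) (f : 'CF(G)) :
    abelian G -> partition KK G -> superclass_fun KK f ->
  f \in <<[seq '1_K | K : {set gT} <- enum KK]>>%VS.
Proof.
move=> cGG partKK fK; have [/eqP covKK tiKK _] := and3P partKK.
have sKG K : K \in KK -> K \subset G.
  by move=> KK_K; rewrite -covKK; apply: bigcup_sup KK_K.
(* The coefficient on [K] is the common value of [f] there; the choice of [repr K] is immaterial. *)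
suffices ->: f = \sum_(K in KK) f (repr K) *: '1_K.
  rewrite rpred_sum // => K KK_K; rewrite rpredZ // memv_span //.
  by apply: map_f; rewrite mem_enum.
apply/cfun_inP=> x Gx; rewrite sum_cfunE.
have KKx : x \in cover KK by rewrite covKK.
rewrite (bigD1 (pblock KK x)) ?pblock_mem //= big1 => [|K /andP[KK_K neqK]].
  rewrite addr0 cfunE cfuni_abelianE ?sKG ?pblock_mem // mem_pblock KKx mulr1.
  apply: fK (pblock_mem KKx) _ _ _ _; rewrite ?mem_pblock //.
  by apply: (mem_repr x); rewrite mem_pblock.
rewrite cfunE cfuni_abelianE ?sKG //.
case: (boolP (x \in K)) => [Kx|]; last by rewrite mulr0.
by rewrite (def_pblock tiKK KK_K Kx) eqxx in neqK.
Qed.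

Lemma cfdot_disjoint_constt (gT : finGroupType) (G : {group gT})
    (A B : {set Iirr G}) (phi psi : 'CF(G)) :
    {subset irr_constt phi <= A} -> {subset irr_constt psi <= B} ->
  [disjoint A & B] -> '[phi, psi] = 0.
Proof.
move=> phiA psiB dAB; rewrite cfdot_sum_irr big1 // => i _.
have [-> | /phiA Ai] := eqVneq '[phi, 'chi_i] 0; first by rewrite mul0r.
have [-> | /psiB Bi] := eqVneq '[psi, 'chi_i] 0; first by rewrite conjC0 mulr0.
by rewrite (disjointFr dAB Ai) in Bi.
Qed.

(** [z A] is the coefficient of [chi A] in the expansion of [f]: for [i] in [A], no other [chi B]
    has ['chi_i] as a constituent. *)
Lemma superclass_fun_cfdot (gT : finGroupType) (G : {group gT})
    (XX : {set {set Iirr G}}) (KK : {set {set gT}})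
    (chi : {set Iirr G} -> 'CF(G)) (f : 'CF(G)) :
    abelian G -> trivIset XX -> partition KK G -> #|XX| = #|KK| ->
    (forall A, A \in XX -> chi A != 0) ->
    (forall A, A \in XX -> {subset irr_constt (chi A) <= A}) ->
    (forall A, A \in XX -> superclass_fun KK (chi A)) ->
    superclass_fun KK f ->
  exists z : {set Iirr G} -> algC,
    forall A i, A \in XX -> i \in A -> '[f, 'chi_i] = z A * '[chi A, 'chi_i].
Proof.
move=> cGG tiXX partKK eqXK nz_chi chiA chiK fK.
have oXX A B : A \in XX -> B \in XX -> A != B -> '[chi A, chi B] = 0.
  move=> XX_A XX_B neqAB.
  apply: cfdot_disjoint_constt (chiA A XX_A) (chiA B XX_B) _.
  exact: (trivIsetP tiXX).
pose S := [seq chi A | A <- enum XX].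
have memS phi : phi \in S -> exists2 A, A \in XX & phi = chi A.
  by case/mapP=> A; rewrite mem_enum; exists A.
have oS : pairwise_orthogonal S.
  apply/pairwise_orthogonalP.
  split=> [|_ _ /memS[A XX_A ->] /memS[B XX_B ->] neqAB].
    rewrite /= map_inj_in_uniq ?enum_uniq ?andbT => [|A B].
      by apply/negP=> /memS[A /nz_chi/eqP nzA /esym].
    rewrite !mem_enum => XX_A XX_B eq_chi.
    (* Equal values at distinct parts would be orthogonal to themselves, hence zero. *)
    apply: contraNeq (nz_chi A XX_A) => neqAB.
    by rewrite -cfnorm_eq0 {2}eq_chi oXX.
  by apply: oXX => //; apply: contraNneq neqAB => ->.
have fS : f \in <<S>>%VS.
  suffices /eqP->: <<S>>%VS == <<[seq '1_K | K : {set gT} <- enum KK]>>%VS.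
    exact: superclass_fun_span.
  (* Dimension count: the span of [S] has dimension [#|XX|], and it lies in the span of [#|KK|]
     indicators. *)
  rewrite eqEdim (eqnP (orthogonal_free oS)) andbC; apply/andP; split.
    by apply: leq_trans (dim_span _) _; rewrite !size_map -!cardE eqXK.
  apply/span_subvP=> _ /memS[A XX_A ->].
  exact: superclass_fun_span (chiK A XX_A).
have [z _ ->] := orthogonal_span oS fS; exists (z \o chi) => A i XX_A Ai.
rewrite big_map big_enum /= cfdot_suml (bigD1 A) //= cfdotZl.
rewrite big1 ?addr0 // => B /andP[XX_B neqBA]; rewrite cfdotZl.
have [-> | /(chiA _ XX_B) Bi] := eqVneq '[chi B, 'chi_i] 0.
  by rewrite mulr0.
by rewrite (disjointFr (trivIsetP tiXX _ _ XX_B XX_A neqBA) Bi) in Ai.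
Qed.

(** Every irreducible character is a constituent of some [chi A], so the part of 1 lies in all
    irreducible kernels, whose intersection is trivial; [cfReg G] vanishes off 1. *)
Lemma superclass_fun_cfReg (gT : finGroupType) (G : {group gT})
    (XX : {set {set Iirr G}}) (KK : {set {set gT}})
    (chi : {set Iirr G} -> 'CF(G)) :
    partition KK G ->
    (forall A, A \in XX -> chi A \is a character) ->
    (forall A, A \in XX -> superclass_fun KK (chi A)) ->
    (forall i : Iirr G, exists2 A, A \in XX & i \in irr_constt (chi A)) ->
  superclass_fun KK (cfReg G).
Proof.
move=> /and3P[/eqP covKK _ _] char_chi chiK irr_chi.
have unit_part K x : K \in KK -> 1%g \in K -> x \in K -> x = 1%g.
  move=> KK_K K1 Kx; apply/set1gP; rewrite -(TI_cfker_irr G).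
  apply/bigcapP=> i _; have [A XX_A Ai] := irr_chi i.
  apply: (subsetP (cfker_constt (char_chi A XX_A) Ai)).
  have Gx : x \in G by rewrite -covKK; apply/bigcupP; exists K.
  by rewrite cfkerEchar ?char_chi // inE Gx (chiK A XX_A K KK_K x 1%g) /=.
move=> K KK_K x y Kx Ky; rewrite !cfRegE; congr (_ *+ (_ : bool)).
apply/eqP/eqP=> eq1.
  by apply: (unit_part K); rewrite // -eq1.
by apply: (unit_part K); rewrite // -eq1.
Qed.

(** The expansion is used twice: for [f], and for [cfReg G], which forces the multiplicities in
    [chi A] to be equal on [A]. *)
Lemma superclass_fun_cfdot_eq (gT : finGroupType) (G : {group gT})
    (XX : {set {set Iirr G}}) (KK : {set {set gT}}) (f : 'CF(G)) :
    abelian G -> supercharacter_theory G XX KK -> superclass_fun KK f ->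
  forall A, A \in XX -> {in A &, forall i j, '[f, 'chi_i] = '[f, 'chi_j]}.
Proof.
move=> cGG [partXX partKK eqXK [chi [char_chi chiA chiK irr_chi]]] fK.
have [_ tiXX notXX0] := and3P partXX.
have nz_chi A : A \in XX -> chi A != 0.
  move=> XX_A; have /set0Pn[i Ai]: A != set0 by apply: contraNneq notXX0 => <-.
  have [B XX_B Bi] := irr_chi i.
  have [eqAB | neqAB] := eqVneq B A.
    rewrite -eqAB; apply: contraTneq Bi => ->.
    by rewrite irr_consttE cfdot0l eqxx.
  have dBA := trivIsetP tiXX _ _ XX_B XX_A neqAB.
  by rewrite (disjointFr dBA (chiA _ XX_B _ Bi)) in Ai.
have chiK' A : A \in XX -> superclass_fun KK (chi A).
  by move=> XX_A K; apply: chiK.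
have cfdotE := superclass_fun_cfdot cGG tiXX partKK eqXK nz_chi chiA chiK'.
have [z fE] := cfdotE f fK.
have [d regE] := cfdotE _ (superclass_fun_cfReg partKK char_chi chiK' irr_chi).
move=> A XX_A.
have mult_chi i : i \in A -> '[chi A, 'chi_i] = (d A)^-1.
  move=> Ai; have /esym := regE A i XX_A Ai.
  have chi1: 'chi[G]_i 1%g = 1 by apply: lin_char1; apply/char_abelianP.
  (* This multiplicity is the degree of ['chi_i], which is 1 as [G] is abelian. *)
  have ->: '[cfReg G, 'chi_i] = 1.
    rewrite cfReg_sum cfdot_suml (bigD1 i) //= cfdotZl cfnorm_irr chi1 mulr1.
    rewrite big1 ?addr0 // => j neqji.
    by rewrite cfdotZl cfdot_irr (negPf neqji) mulr0.
  move=> dchi1; have nz_d: d A != 0.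
    by apply: contra_eq_neq dchi1 => ->; rewrite mul0r eq_sym oner_eq0.
  by apply: (mulfI nz_d); rewrite dchi1 mulfV.
by move=> i j Ai Aj; rewrite !(fE A) // !mult_chi.
Qed.

Lemma superclass_sum_irr (gT : finGroupType) (G : {group gT})
    (XX : {set {set Iirr G}}) (KK : {set {set gT}}) (K : {set gT}) :
    abelian G -> supercharacter_theory G XX KK -> K \in KK ->
  forall A, A \in XX ->
    {in A &, forall i j, \sum_(g in K) 'chi_i g = \sum_(g in K) 'chi_j g}.
Proof.
move=> cGG sct KK_K A XX_A i j Ai Aj.
have [_ /and3P[/eqP covKK tiKK _] _ _] := sct.
have sKG L : L \in KK -> L \subset G.
  by move=> KK_L; rewrite -covKK; apply: bigcup_sup KK_L.
have oneK: superclass_fun KK ('1_K : 'CF(G)).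
  move=> L KK_L x y Lx Ly; rewrite !cfuni_abelianE ?sKG //.
  have [<- | neqLK] := eqVneq L K; first by rewrite Lx Ly.
  have dLK := trivIsetP tiKK _ _ KK_L KK_K neqLK.
  by rewrite !(disjointFr dLK).
(* The outer conjugation undoes the one that the inner product puts on its second argument. *)
have dotE (k : Iirr G) : \sum_(g in K) 'chi_k g = (#|G|%:R * '['1_K, 'chi_k])^*.
  rewrite cfdotE mulVKf ?neq0CG // rmorph_sum /= [RHS](big_setID K) /=.
  rewrite (setIidPr (sKG K KK_K)).
  rewrite [X in _ + X]big1 ?addr0 => [|x /setDP[_ notKx]].
    by apply: eq_bigr => x Kx; rewrite cfuni_abelianE ?sKG // Kx mul1r conjCK.
  by rewrite cfuni_abelianE ?sKG // (negPf notKx) mul0r conjC0.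
by rewrite !dotE (superclass_fun_cfdot_eq cGG sct oneK XX_A Ai Aj).
Qed.

(** Injectivity is asked on [D] only, since [tilde] is meaningful only on [G]. The second conclusion
    serves to count the parts of the image. *)
Lemma imset_partition_in (aT rT : finType) (f : aT -> rT) (D : {set aT})
    (P : {set {set aT}}) :
    {in D &, injective f} -> partition P D ->
  partition [set f @: B | B : {set aT} in P] (f @: D)
  /\ {in P &, injective (fun B : {set aT} => f @: B)}.
Proof.
move=> injf /and3P[/eqP covP tiP notP0].
have sPD B : B \in P -> B \subset D.
  by move=> PB; rewrite -covP; apply: bigcup_sup PB.
have [||partP injP] :=
  @indexed_partition _ _ (mem P) (fun B : {set aT} => f @: B).
- move=> A B PA PB neqBA; apply/pred0P=> y; apply/andP=> -[/imsetP[a Aa ->]].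
  case/imsetP=> b Bb /injf eqab; have dBA := trivIsetP tiP _ _ PB PA neqBA.
  have Ab: b \in A.
    by rewrite -(eqab (subsetP (sPD A PA) a Aa) (subsetP (sPD B PB) b Bb)).
  by rewrite (disjointFr dBA Bb) in Ab.
- by move=> A PA; rewrite imset_eq0; apply: contraNneq notP0 => <-.
suffices <-: cover [set f @: B | B : {set aT} in P] = f @: D by [].
rewrite cover_imset -covP /cover; apply/setP=> y.
apply/bigcupP/imsetP=> [[A PA /imsetP[a Aa ->]] | [a /bigcupP[A PA Aa] ->]].
  by exists a => //; apply/bigcupP; exists A.
by exists A; rewrite ?imset_f.
Qed.

(** Irreducible characters separate conjugacy classes, which are singletons here. *)
Lemma tilde_inj (gT : finGroupType) (G : {group gT}) (cGG : abelian G) :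
  {in G &, injective (tilde cGG)}.
Proof.
move=> g h Gg Gh eq_gh; apply/set1P.
rewrite -(abelian_classP _ cGG h Gh); apply/eq_irr_mem_classP => // i.
by rewrite -(tildeE (cGG := cGG) i Gg) eq_gh tildeE.
Qed.

(** By injectivity and counting: an abelian group has as many irreducible characters as elements,
    applied to [G] and to its dual. *)
Lemma tilde_setT (gT : finGroupType) (G : {group gT}) (cGG : abelian G) :
  tilde cGG @: G = setT.
Proof.
apply/eqP; rewrite eqEcard subsetT card_in_imset; last exact: tilde_inj.
rewrite cardsT (card_Iirr_abelian (dual_abelian cGG)) cardsT.
by rewrite -(card_Iirr_abelian cGG) leqnn.
Qed.

Theorem theorem10p2 (gT : finGroupType) (G : {group gT}) (cGG : abelian G)
    (XX : {set {set Iirr G}}) (KK : {set {set gT}}) :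
  supercharacter_theory G XX KK ->
  supercharacter_theory [set: dual_group cGG]%G (tilde_part cGG KK) XX.
Proof.
move=> sct; have [partXX partKK eqXK _] := sct.
have [/eqP covKK _ _] := and3P partKK.
have [partK inj_tilde] := imset_partition_in (tilde_inj (cGG := cGG)) partKK.
rewrite tilde_setT in partK.
(* This is the standard choice $\sigma_B$, all degrees being 1 on the abelian dual group. *)
pose chi (B : {set Iirr [set: dual_group cGG]}) := \sum_(j in B) 'chi_j.
have chi_constt B j : (j \in irr_constt (chi B)) = (j \in B).
  rewrite irr_consttE cfdot_suml; have [Bj | notBj] := boolP (j \in B).
    rewrite (bigD1 j) //= cfnorm_irr big1 ?addr0 ?oner_eq0 // => k.
    by case/andP=> _ neqkj; rewrite cfdot_irr (negPf neqkj).
  rewrite big1 ?eqxx // => k Bk; rewrite cfdot_irr.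
  by case: eqP Bk notBj => // -> ->.
split=> //; first by rewrite card_in_imset.
exists chi; split.
- by move=> B _; apply: rpred_sum => j _; apply: irr_char.
- by move=> B _ j; rewrite chi_constt.
- move=> _ A /imsetP[K KK_K ->] XX_A i j Ai Aj.
  have sKG: K \subset G by rewrite -covKK; apply: bigcup_sup KK_K.
  (* Duality swaps the roles: the point [k] of the dual becomes a character evaluated along [K]. *)
  have chiE k : chi (tilde cGG @: K) k = \sum_(g in K) 'chi[G]_k g.
    rewrite sum_cfunE big_imset /=; last first.
      by move=> g h /(subsetP sKG) Gg /(subsetP sKG) Gh; apply: tilde_inj.
    by apply: eq_bigr => g /(subsetP sKG) Gg; rewrite tildeE.
  by rewrite !chiE (superclass_sum_irr cGG sct KK_K XX_A Ai Aj).
move=> i; have: i \in cover (tilde_part cGG KK).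
  by have [/eqP-> _ _] := and3P partK; rewrite inE.
by case/bigcupP=> B KB Bi; exists B; rewrite ?chi_constt.
Qed.
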